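(* Let $\mathcal G=(V,\mathcal E)$ be a temporal graph, $n=|V|$, and let $(\star)$ be one of the optimality criteria shortest, shortest-foremost, prefix-foremost. Let $s$ be drawn uniformly at random from $V$, and for $v\in V$ let $$\widetilde b^{(\star)}(v\mid s)=\frac1{n-1}\sum_{z\in V,\ z\ne s}\frac{\sigma^{(\star)}_{sz}(v)}{\sigma^{(\star)}_{sz}}.$$ Then $\widetilde b^{(\star)}(v\mid s)$ is an unbiased estimator of the $(\star)$-temporal betweenness centrality: $\mathbf E[\widetilde b^{(\star)}(v\mid s)]=\mathtt b^{(\star)}_v$ for every $v\in V$.
   Context: A (directed) temporal graph is $\mathcal G=(V,\mathcal E)$ with $V$ finite, $n=|V|\ge2$, and $\mathcal E$ a finite set of temporal edges $(u,v,t)$, $u,v\in V$, $t\in T=\{1,\dots,|T|\}$. A temporal path from $s$ to $z\ne s$ is a sequence $((u_1,t_1),\dots,(u_k,t_k))$ with $u_1=s$, $u_k=z$, $t_1=0$, $t_i<t_{i+1}$ and $(u_i,u_{i+1},t_{i+1})\in\mathcal E$. Its length is $k-1$, its arrival time $t_k$; it is foremost if no temporal path from $s$ to $z$ arrives earlier (the trivial path from $s$ to itself arrives at time $0$). $(\star)$-optimal means: shortest (minimum length), shortest-foremost (minimum length among foremost paths), or prefix-foremost (foremost with every prefix foremost). $\sigma^{(\star)}_{sz}$ is the number of $(\star)$-optimal temporal paths from $s$ to $z$ and $\sigma^{(\star)}_{sz}(v)$ the number of those passing through $v$ for $v\notin\{s,z\}$, with $\sigma^{(\star)}_{sz}(v)=0$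 if $v\in\{s,z\}$; the ratio $\sigma^{(\star)}_{sz}(v)/\sigma^{(\star)}_{sz}$ is $0$ if $\sigma^{(\star)}_{sz}=0$. The $(\star)$-temporal betweenness is $\mathtt b^{(\star)}_v=\frac1{n(n-1)}\sum_{s\ne v\ne z,\ s\ne z}\sigma^{(\star)}_{sz}(v)/\sigma^{(\star)}_{sz}$. *)

(* Defs.v *)
(* Libraries: MathComp and MathComp-Analysis. *)
From HB Require Import structures.
From mathcomp Require Import all_boot all_order all_algebra.
From mathcomp Require Import all_classical all_reals all_analysis.
From mathcomp Require Import zify.

Set Implicit Arguments.
Unset Strict Implicit.
Unset Printing Implicit Defensive.

Import Order.TTheory GRing.Theory Num.Theory.

Local Open Scope ring_scope.

(* Time instants are 0, 1, ..., lifetime; instant 0 is only the starting time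
   of paths, the times of edges lie in {1, ..., lifetime}. *)
Record temporal_graph (V : finType) := TemporalGraph {
  lifetime : nat;
  tedges : {set V * V * 'I_lifetime.+1};
  tedges_gt0 : forall e, e \in tedges -> (0 < e.2)%N
}.

Inductive criterion := Shortest | ShortestForemost | PrefixForemost.

Section TemporalPaths.
Variables (V : finType) (G : temporal_graph V).
Local Notation L := (lifetime G).

Definition appearance : Type := (V * 'I_L.+1)%type.

Definition tstep (x y : appearance) : bool :=
  (x.2 < y.2)%N && ((x.1, y.1, y.2) \in tedges G).

(* For z = s the trivial path [:: (s, 0)] is included; it is needed to decide
   whether a prefix that comes back to s is foremost. *)
Definition temporal_path (s z : V) (p : seq appearance) : bool :=
  if p is x :: q then
    [&& x == (s, ord0), path tstep x q & (last x q).1 == z]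
  else false.

Definition tlength (p : seq appearance) : nat := (size p).-1.

Definition arrival (p : seq appearance) : nat :=
  last 0%N [seq nat_of_ord x.2 | x <- p].

Definition endpoint (s : V) (p : seq appearance) : V :=
  last s [seq x.1 | x <- p].

(* Times increase strictly, so this finite type contains every temporal path;
   see size_temporal_path. *)
Definition bpath : Type := {bseq L.+1 of appearance}.

Definition shortest (s z : V) (p : seq appearance) : bool :=
  temporal_path s z p &&
  [forall q : bpath, temporal_path s z q ==> (tlength p <= tlength q)%N].

Definition foremost (s z : V) (p : seq appearance) : bool :=
  temporal_path s z p &&
  [forall q : bpath, temporal_path s z q ==> (arrival p <= arrival q)%N].

Definition shortest_foremost (s z : V) (p : seq appearance) : bool :=
  foremost s z p &&
  [forall q : bpath, foremost s z q ==> (tlength p <= tlength q)%N].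

Definition prefix_foremost (s z : V) (p : seq appearance) : bool :=
  foremost s z p &&
  [forall i : 'I_(size p),
     foremost s (endpoint s (take i.+1 p)) (take i.+1 p)].

Definition optimal (c : criterion) : V -> V -> seq appearance -> bool :=
  match c with
  | Shortest => shortest
  | ShortestForemost => shortest_foremost
  | PrefixForemost => prefix_foremost
  end.

Definition sigma (c : criterion) (s z : V) : nat :=
  #|[pred p : bpath | optimal c s z p]|.

Definition sigma_through (c : criterion) (s z v : V) : nat :=
  if (v == s) || (v == z) then 0%N
  else #|[pred p : bpath | optimal c s z p && (v \in [seq x.1 | x <- p])]|.

Lemma size_temporal_path s z p : temporal_path s z p -> (size p <= L.+1)%N.
Proof.
case: p => [//|x q] /and3P[_ xq _] /=; rewrite ltnS.
suff : (size q + x.2 <= (last x q).2)%N by move: (ltn_ord (last x q).2); lia.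
elim: q x xq => [|y q IHq] x //= /andP[/andP[xy _] /IHq]; lia.
Qed.

Lemma forall_bpathP (Q C : pred (seq appearance)) :
  (forall p, Q p -> (size p <= L.+1)%N) ->
  reflect (forall q, Q q -> C q) [forall q : bpath, Q q ==> C q].
Proof.
move=> bQ; apply: (iffP forallP) => [QC q Qq|QC q]; last exact/implyP/QC.
exact: (implyP (QC (Bseq (bQ q Qq)))).
Qed.

Lemma shortestP s z p :
  reflect (temporal_path s z p /\
           forall q, temporal_path s z q -> (tlength p <= tlength q)%N)
          (shortest s z p).
Proof.
apply: (iffP andP) => -[? H]; split=> //; move: H;
  by move/(forall_bpathP (fun q => leq (tlength p) (tlength q))
             (@size_temporal_path s z)).
Qed.

Lemma foremostP s z p :
  reflect (temporal_path s z p /\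
           forall q, temporal_path s z q -> (arrival p <= arrival q)%N)
          (foremost s z p).
Proof.
apply: (iffP andP) => -[? H]; split=> //; move: H;
  by move/(forall_bpathP (fun q => leq (arrival p) (arrival q))
             (@size_temporal_path s z)).
Qed.

Lemma shortest_foremostP s z p :
  reflect (foremost s z p /\
           forall q, foremost s z q -> (tlength p <= tlength q)%N)
          (shortest_foremost s z p).
Proof.
have bF q : foremost s z q -> (size q <= L.+1)%N.
  by move=> /andP[/size_temporal_path].
apply: (iffP andP) => -[? H]; split=> //; move: H;
  by move/(forall_bpathP (fun q => leq (tlength p) (tlength q)) bF).
Qed.

Lemma optimal_temporal_path c s z p : optimal c s z p -> temporal_path s z p.
Proof. by case: c => /andP[] // /andP[]. Qed.

End TemporalPaths.

Section Betweenness.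
Variables (R : realType) (V : finType) (G : temporal_graph V).
Variable c : criterion.

(* Division by 0 yields 0, which is the convention when sigma vanishes. *)
Definition sigma_ratio (s z v : V) : R :=
  (sigma_through G c s z v)%:R / (sigma G c s z)%:R.

Definition betweenness (v : V) : R :=
  (#|V|%:R * (#|V|%:R - 1))^-1 *
  \sum_(s | s != v) \sum_(z | (z != v) && (z != s)) sigma_ratio s z v.

Definition betweenness_estimator (v s : V) : R :=
  (#|V|%:R - 1)^-1 * \sum_(z | z != s) sigma_ratio s z v.

End Betweenness.

(* V carries no sigma-algebra; measurability for the discrete one amounts to
   measurability of the fibres. *)
Definition uniformly_distributed (R : realType) (d : measure_display)
    (Omega : measurableType d) (P : probability Omega R) (V : finType)
    (X : Omega -> V) : Prop :=
  forall u : V, measurable [set w | X w = u]%classic /\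
                P [set w | X w = u]%classic = (#|V|%:R^-1)%:E.

(* Main.v *)
(* The expectation of a function of a uniform source is its average over V. In
   that average the terms with s = v or z = v vanish, because sigma_sz(v) is 0
   when v is an endpoint; what remains is the sum defining the betweenness. *)
Require Import Defs.
From mathcomp Require Import all_boot all_order all_algebra.
From mathcomp Require Import all_classical all_reals all_analysis.

Import Order.TTheory GRing.Theory Num.Theory.

(** [f (X w)] is a finite linear combination of indicators of the fibres of [X], and [hX] gives the
    measurability and mass of each fibre. *)
Lemma expectation_uniformly_distributed (R : realType) (V : finType)
    (d : measure_display) (Omega : measurableType d) (P : probability Omega R)
    (X : Omega -> V) (hX : uniformly_distributed P X) (f : V -> R) :
  ('E_P[fun w => f (X w)] = (#|V|%:R^-1 * \sum_u f u)%R%:E)%E.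
Proof.
rewrite unlock.
transitivity (\int[P]_w \sum_(u : V) ((f u)%:E * (\1_[set w | X w = u] w)%:E))%E.
  apply: eq_integral => w _.
  rewrite (bigD1 (X w)) //= big1 ?adde0; last first.
    by move=> u uX; rewrite indicE memNset ?mule0// => /= Xu; rewrite Xu eqxx in uX.
  by rewrite indicE mem_set// mule1.
have mX u : measurable [set w | X w = u] by case: (hX u).
(* [f] may change sign, so integrability of the indicators is what lets the integral pass through
   the sum and the factor [f u]. *)
have iX u : P.-integrable setT (fun w => (\1_[set w | X w = u] w)%:E).
  exact: integrable_indic.
rewrite integral_sum//; last by move=> u; exact: integrableZl.
rewrite mulr_sumr -sumEFin; apply: eq_bigr => u _.
rewrite integralZl// integral_indic// setIT [in RHS]mulrC EFinM.
by congr (_ * _)%E; case: (hX u).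
Qed.

Lemma sigma_ratio_endpoint (R : realType) (V : finType) (G : temporal_graph V)
    (c : criterion) (s z v : V) :
  (v == s) || (v == z) -> sigma_ratio R G c s z v = 0%R.
Proof. by rewrite /sigma_ratio /sigma_through => ->; rewrite mul0r. Qed.

Theorem lemma6 (R : realType) (V : finType) (hV : (1 < #|V|)%N)
    (G : temporal_graph V) (c : criterion)
    (d : measure_display) (Omega : measurableType d) (P : probability Omega R)
    (s : Omega -> V) (hs : uniformly_distributed P s) (v : V) :
  ('E_P[fun w => betweenness_estimator R G c v (s w)]
    = (betweenness R G c v)%:E)%E.
Proof.
rewrite (expectation_uniformly_distributed _ _ _ _ _ _ hs); congr EFin.
rewrite /betweenness /betweenness_estimator -mulr_sumr mulrA -invfM; congr (_ * _)%R.
(* Split off the source [v]: its whole inner sum is zero. *)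
rewrite (bigD1 v) //= big1 ?add0r; last first.
  by move=> z _; rewrite sigma_ratio_endpoint ?eqxx.
apply: eq_bigr => u uv.
(* For a source [u != v], the target [v] does occur among the [z != u]; its single term is zero. *)
rewrite (bigD1 v) 1?eq_sym //= sigma_ratio_endpoint ?eqxx ?orbT// add0r.
by apply: eq_bigl => z; rewrite andbC.
Qed.
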